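(* Let $(A,\ast,\alpha)$ be a Hom-alternative algebra, $(V,\mathfrak l,\mathfrak r,\beta)$ a bimodule of $A$, and $T:V\to A$ a Kupershmidt operator of $(A,\ast,\alpha)$ with respect to $(V,\mathfrak l,\mathfrak r,\beta)$. Then $(V,\prec,\succ,\beta)$ is a Hom-pre-alternative algebra, where for all $a,b\in V$ $$a\succ b=\mathfrak l(T(a))b,\qquad a\prec b=\mathfrak r(T(b))a.$$ Moreover, if $(V,\cdot,\beta)$ is the multiplicative Hom-pre-Malcev algebra associated (through $T$) to the Hom-Malcev admissible algebra $(A,[-,-],\alpha)$, $[x,y]=x\ast y-y\ast x$, on the representation $(V,\mathfrak l-\mathfrak r,\beta)$, then $a\cdot b=a\succ b-b\prec a$ for all $a,b\in V$.
   Context: All vector spaces are over a field $\mathbb K$ of characteristic $0$. A Hom-alternative algebra $(A,\ast,\alpha)$ is a vector space $A$ with a bilinear product $\ast$ and a linear map $\alpha:A\to A$ such that $as_\alpha(x,x,y)=as_\alpha(y,x,x)=0$ for all $x,y\in A$, where $as_\alpha(x,y,z)=(x\ast y)\ast\alpha(z)-\alpha(x)\ast(y\ast z)$. A bimodule $(V,\mathfrak l,\mathfrak r,\beta)$ of $(A,\ast,\alpha)$ is a vector space $V$, a linear map $\beta:V\to V$, and linear maps $\mathfrak l,\mathfrak r:A\to \mathrm{End}(V)$ such that for all $x,y\in A$ (with $x^2=x\ast x$): $\mathfrak l(x^2)\beta=\mathfrak l(\alpha(x))\mathfrak l(x)$; $\mathfrak r(x^2)\beta=\mathfrak r(\alpha(x))\mathfrak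 r(x)$; $\mathfrak r(\alpha(y))\mathfrak l(x)-\mathfrak l(\alpha(x))\mathfrak r(y)=\mathfrak r(x\ast y)\beta-\mathfrak r(\alpha(y))\mathfrak r(x)$; $\mathfrak l(y\ast x)\beta-\mathfrak l(\alpha(y))\mathfrak l(x)=\mathfrak l(\alpha(y))\mathfrak r(x)-\mathfrak r(\alpha(x))\mathfrak l(y)$. A Kupershmidt operator of $(A,\ast,\alpha)$ with respect to $(V,\mathfrak l,\mathfrak r,\beta)$ is a linear map $T:V\to A$ such that $\alpha\circ T=T\circ\beta$ and $T(a)\ast T(b)=T\big(\mathfrak l(T(a))b+\mathfrak r(T(b))a\big)$ for all $a,b\in V$. A Hom-pre-alternative algebra $(B,\prec,\succ,\gamma)$ is a vector space $B$ with bilinear products $\prec,\succ$ and a linear map $\gamma:B\to B$ such that, writing $x\ast y=x\prec y+x\succ y$, for all $x,y,z\in B$: $(x\succ y)\prec\gamma(z)-\gamma(x)\succ(y\prec z)+(y\prec x)\prec\gamma(z)-\gamma(y)\prec(x\ast z)=0$; $(x\succ y)\prec\gamma(z)-\gamma(x)\succ(y\prec z)+(x\ast z)\succ\gamma(y)-\gamma(x)\succ(z\succ y)=0$; $(x\ast y)\succ\gamma(z)-\gamma(x)\succ(y\succ z)+(y\ast x)\succ\gamma(z)-\gamma(y)\succ(x\succ z)=0$; $(x\prec y)\prec\gamma(z)-\gamma(x)\prec(y\ast z)+(x\prec z)\prec\gamma(y)-\gamma(x)\prec(z\ast y)=0$. Given a Hom-Malcev algebra $(A,[-,-],\alpha)$,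 a representation $(V,\varrho,\beta)$ and a linear $T:V\to A$ with $\alpha T=T\beta$ and $[T(a),T(b)]=T(\varrho(T(a))b-\varrho(T(b))a)$, the Hom-pre-Malcev algebra on $V$ associated to this data through $T$ has product $a\cdot b=\varrho(T(a))b$ and twisting map $\beta$; here $\varrho=\mathfrak l-\mathfrak r$. *)

(* Defs.v *)
From HB Require Import structures.
From mathcomp Require Import all_boot all_order all_algebra.

Set Implicit Arguments.
Unset Strict Implicit.
Unset Printing Implicit Defensive.

Import GRing.Theory.
Local Open Scope ring_scope.

(* The structures are predicates on plain functions, so that linearity and     *)
(* bilinearity are part of what has to be proved of the constructed products.  *)
(* A linear map l : A -> End(V) is represented by its uncurried bilinear form  *)
(* l : A -> V -> V.                                                            *)
Definition is_bilinear (K : fieldType) (U V W : lmodType K)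
    (f : U -> V -> W) : Prop :=
  (forall v, linear (fun u => f u v)) /\ (forall u, linear (f u)).

Definition hom_associator (K : fieldType) (A : lmodType K)
    (mul : A -> A -> A) (alpha : A -> A) (x y z : A) : A :=
  mul (mul x y) (alpha z) - mul (alpha x) (mul y z).

Record hom_alternative (K : fieldType) (A : lmodType K)
    (mul : A -> A -> A) (alpha : A -> A) : Prop := HomAlternative {
  hom_alt_bilinear : is_bilinear mul;
  hom_alt_linear : linear alpha;
  hom_alt_left : forall x y, hom_associator mul alpha x x y = 0;
  hom_alt_right : forall x y, hom_associator mul alpha y x x = 0
}.

Record hom_alt_bimodule (K : fieldType) (A V : lmodType K)
    (mul : A -> A -> A) (alpha : A -> A)
    (l r : A -> V -> V) (beta : V -> V) : Prop := HomAltBimodule {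
  bimod_linear : linear beta;
  bimod_l_bilinear : is_bilinear l;
  bimod_r_bilinear : is_bilinear r;
  bimod_l_sq : forall x v, l (mul x x) (beta v) = l (alpha x) (l x v);
  bimod_r_sq : forall x v, r (mul x x) (beta v) = r (alpha x) (r x v);
  bimod_rl : forall x y v,
    r (alpha y) (l x v) - l (alpha x) (r y v)
      = r (mul x y) (beta v) - r (alpha y) (r x v);
  bimod_lr : forall x y v,
    l (mul y x) (beta v) - l (alpha y) (l x v)
      = l (alpha y) (r x v) - r (alpha x) (l y v)
}.

Record kupershmidt_operator (K : fieldType) (A V : lmodType K)
    (mul : A -> A -> A) (alpha : A -> A)
    (l r : A -> V -> V) (beta : V -> V) (T : V -> A) : Prop :=
  KupershmidtOperator {
  kup_linear : linear T;
  kup_twist : forall a, alpha (T a) = T (beta a);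
  kup_mul : forall a b, mul (T a) (T b) = T (l (T a) b + r (T b) a)
}.

Record hom_pre_alternative (K : fieldType) (B : lmodType K)
    (prec succ : B -> B -> B) (gamma : B -> B) : Prop := HomPreAlternative {
  hpa_prec_bilinear : is_bilinear prec;
  hpa_succ_bilinear : is_bilinear succ;
  hpa_linear : linear gamma;
  hpa_ax1 : let mul x y := prec x y + succ x y in forall x y z,
    prec (succ x y) (gamma z) - succ (gamma x) (prec y z)
      + prec (prec y x) (gamma z) - prec (gamma y) (mul x z) = 0;
  hpa_ax2 : let mul x y := prec x y + succ x y in forall x y z,
    prec (succ x y) (gamma z) - succ (gamma x) (prec y z)
      + succ (mul x z) (gamma y) - succ (gamma x) (succ z y) = 0;
  hpa_ax3 : let mul x y := prec x y + succ x y in forall x y z,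
    succ (mul x y) (gamma z) - succ (gamma x) (succ y z)
      + succ (mul y x) (gamma z) - succ (gamma y) (succ x z) = 0;
  hpa_ax4 : let mul x y := prec x y + succ x y in forall x y z,
    prec (prec x y) (gamma z) - prec (gamma x) (mul y z)
      + prec (prec x z) (gamma y) - prec (gamma x) (mul z y) = 0
}.

Definition commutator (K : fieldType) (A : lmodType K)
    (mul : A -> A -> A) (x y : A) : A := mul x y - mul y x.

Definition hom_jacobian (K : fieldType) (A : lmodType K)
    (brk : A -> A -> A) (alpha : A -> A) (x y z : A) : A :=
  brk (brk x y) (alpha z) + brk (brk y z) (alpha x) + brk (brk z x) (alpha y).

(* Yau's Hom-Malcev identity. *)
Record hom_malcev (K : fieldType) (A : lmodType K)
    (brk : A -> A -> A) (alpha : A -> A) : Prop := HomMalcev {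
  hm_bilinear : is_bilinear brk;
  hm_linear : linear alpha;
  hm_skew : forall x y, brk x y = - brk y x;
  hm_malcev : forall x y z,
    hom_jacobian brk alpha (alpha x) (alpha y) (brk x z)
      = brk (hom_jacobian brk alpha x y z) (alpha (alpha x))
}.

Definition hom_malcev_admissible (K : fieldType) (A : lmodType K)
    (mul : A -> A -> A) (alpha : A -> A) : Prop :=
  [/\ is_bilinear mul, linear alpha & hom_malcev (commutator mul) alpha].

(* For alpha = id and beta = id this is the usual notion of representation of  *)
(* a Malcev algebra:                                                           *)
(* rho [[x,y],z] = rho x rho y rho z - rho z rho x rho y                       *)
(*                 + rho y rho [z,x] - rho [y,z] rho x.                        *)
Record hom_malcev_rep (K : fieldType) (A V : lmodType K)
    (brk : A -> A -> A) (alpha : A -> A)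
    (rho : A -> V -> V) (beta : V -> V) : Prop := HomMalcevRep {
  hmr_linear : linear beta;
  hmr_bilinear : is_bilinear rho;
  hmr_twist : forall x v, beta (rho x v) = rho (alpha x) (beta v);
  hmr_rep : forall x y z v,
    rho (brk (brk x y) (alpha z)) (beta (beta v))
      = rho (alpha (alpha x)) (rho (alpha y) (rho z v))
        - rho (alpha (alpha z)) (rho (alpha x) (rho y v))
        + rho (alpha (alpha y)) (rho (brk z x) (beta v))
        - rho (alpha (brk y z)) (rho (alpha x) (beta v))
}.

Record hom_pre_malcev (K : fieldType) (B : lmodType K)
    (dot : B -> B -> B) (gamma : B -> B) : Prop := HomPreMalcev {
  hpm_bilinear : is_bilinear dot;
  hpm_linear : linear gamma;
  hpm_ax : let brk := commutator dot in forall x y z t,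
    dot (gamma (brk y z)) (gamma (dot x t))
      + dot (brk (brk x y) (gamma z)) (gamma (gamma t))
      + dot (gamma (gamma y)) (dot (brk x z) (gamma t))
      - dot (gamma (gamma x)) (dot (gamma y) (dot z t))
      + dot (gamma (gamma z)) (dot (gamma x) (dot y t)) = 0
}.

Definition multiplicative (B : Type) (dot : B -> B -> B) (gamma : B -> B) :
    Prop :=
  forall x y, gamma (dot x y) = dot (gamma x) (gamma y).

(* (V, dot, beta) is the multiplicative Hom-pre-Malcev algebra associated,     *)
(* through T, to the Hom-Malcev algebra (A, brk, alpha) and its representation *)
(* (V, rho, beta).                                                             *)
Record associated_hom_pre_malcev (K : fieldType) (A V : lmodType K)
    (brk : A -> A -> A) (alpha : A -> A)
    (rho : A -> V -> V) (beta : V -> V) (T : V -> A)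
    (dot : V -> V -> V) : Prop := AssociatedHomPreMalcev {
  ahpm_malcev : hom_malcev brk alpha;
  ahpm_rep : hom_malcev_rep brk alpha rho beta;
  ahpm_T_linear : linear T;
  ahpm_T_twist : forall a, alpha (T a) = T (beta a);
  ahpm_T_brk : forall a b, brk (T a) (T b) = T (rho (T a) b - rho (T b) a);
  ahpm_dot : forall a b, dot a b = rho (T a) b;
  ahpm_pre_malcev : hom_pre_malcev dot beta;
  ahpm_multiplicative : multiplicative dot beta
}.

(* Main.v *)
Require Import Defs.
From mathcomp Require Import all_boot all_order all_algebra.

(** The Kupershmidt identity says that [T] maps the sum product
    [a * b = a < b + a > b] on [V] to the product of [A]
    ([kupershmidt_sum_product]), and the twisting condition says that it
    intertwines [beta] with [alpha].  Once both are used to push [T] inside,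
    each axiom of a Hom-pre-alternative algebra on [V] is an axiom of the
    bimodule evaluated at elements of the image of [T]: the first two are the
    compatibility conditions between [l] and [r], the last two are the
    polarizations ([polarized_square]) of the square conditions on [l] and [r].
    The Hom-pre-Malcev product associated to the commutator bracket is
    [(l - r)(T a) b], which is [a > b - b < a] by unfolding. *)

Import GRing.Theory.
Local Open Scope ring_scope.

Set Implicit Arguments.
Unset Strict Implicit.

Lemma linear_addE (K : fieldType) (U W : lmodType K) (f : U -> W) :
  linear f -> {morph f : x y / x + y}.
Proof. by move=> lin_f x y; have := lin_f 1 x y; rewrite !scale1r. Qed.

Lemma bilinear_addl (K : fieldType) (U V W : lmodType K) (f : U -> V -> W) :
  is_bilinear f -> forall v, {morph f^~ v : x y / x + y}.
Proof. by case=> lin_l _ v; apply: linear_addE. Qed.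

Lemma bilinear_addr (K : fieldType) (U V W : lmodType K) (f : U -> V -> W) :
  is_bilinear f -> forall u, {morph f u : x y / x + y}.
Proof. by case=> _ lin_r u; apply: linear_addE. Qed.

Lemma bilinear_precomp_left (K : fieldType) (U U' V W : lmodType K)
    (f : U -> V -> W) (g : U' -> U) :
  is_bilinear f -> linear g -> is_bilinear (fun u v => f (g u) v).
Proof.
by move=> [lin_l lin_r] lin_g; split=> [v c x y|u]; rewrite ?lin_g ?lin_l.
Qed.

Lemma bilinear_swap (K : fieldType) (U V W : lmodType K) (f : U -> V -> W) :
  is_bilinear f -> is_bilinear (fun v u => f u v).
Proof. by case. Qed.

(** Evaluate the square condition at [x + y] and cancel the two pure terms;
    what remains is the condition symmetrized in [x] and [y]. *)
Lemma polarized_square (K : fieldType) (A V : lmodType K)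
    (mul : A -> A -> A) (alpha : A -> A) (f : A -> V -> V) (beta : V -> V) :
    is_bilinear mul -> linear alpha -> is_bilinear f ->
    (forall x v, f (mul x x) (beta v) = f (alpha x) (f x v)) ->
  forall x y v, f (mul x y) (beta v) + f (mul y x) (beta v)
                = f (alpha x) (f y v) + f (alpha y) (f x v).
Proof.
move=> bil_mul lin_alpha bil_f sq x y v; have := sq (x + y) v.
rewrite (linear_addE lin_alpha) (bilinear_addl bil_mul).
rewrite !(bilinear_addr bil_mul) !(bilinear_addl bil_f).
rewrite !(bilinear_addr bil_f) !sq -!addrA => /addrI.
by rewrite !addrA => /addIr.
Qed.

Lemma kupershmidt_sum_product (K : fieldType) (A V : lmodType K)
    (mul : A -> A -> A) (alpha : A -> A)
    (l r : A -> V -> V) (beta : V -> V) (T : V -> A) :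
    kupershmidt_operator mul alpha l r beta T ->
  forall a b, T (r (T b) a + l (T a) b) = mul (T a) (T b).
Proof. by move=> hT a b; rewrite addrC (kup_mul hT). Qed.

Lemma kupershmidt_hom_pre_alternative (K : fieldType) (A V : lmodType K)
    (mul : A -> A -> A) (alpha : A -> A)
    (l r : A -> V -> V) (beta : V -> V) (T : V -> A) :
    hom_alternative mul alpha ->
    hom_alt_bimodule mul alpha l r beta ->
    kupershmidt_operator mul alpha l r beta T ->
  hom_pre_alternative (fun a b => r (T b) a) (fun a b => l (T a) b) beta.
Proof.
move=> hA hV hT.
have Tmul := kupershmidt_sum_product hT.
have bil_mul := hom_alt_bilinear hA; have lin_alpha := hom_alt_linear hA.
have bil_l := bimod_l_bilinear hV; have bil_r := bimod_r_bilinear hV.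
have lin_T := kup_linear hT.
split=> [|||||/= x y z|/= x y z].
- exact/bilinear_swap/bilinear_precomp_left.
- exact: bilinear_precomp_left.
- exact: bimod_linear hV.
- move=> /= x y z; rewrite Tmul -!(kup_twist hT) (bimod_rl hV).
  by rewrite subrK subrr.
- move=> /= x y z; rewrite Tmul -!(kup_twist hT) -addrA (bimod_lr hV).
  by rewrite addrC subrKA subrr.
- rewrite !Tmul -!(kup_twist hT) -[LHS]addrA addrACA -opprD.
  by rewrite (polarized_square bil_mul lin_alpha bil_l (bimod_l_sq hV)) subrr.
- rewrite !Tmul -!(kup_twist hT) -[LHS]addrA addrACA -opprD.
  rewrite (polarized_square bil_mul lin_alpha bil_r (bimod_r_sq hV)).
  by rewrite [X in _ - X]addrC subrr.
Qed.

Unset Implicit Arguments.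
Set Strict Implicit.

Theorem theorem3p2 (K : fieldType) (charK0 : [pchar K] =i pred0)
    (A V : lmodType K)
    (mul : A -> A -> A) (alpha : A -> A)
    (l r : A -> V -> V) (beta : V -> V) (T : V -> A)
    (hA : hom_alternative mul alpha)
    (hV : hom_alt_bimodule mul alpha l r beta)
    (hT : kupershmidt_operator mul alpha l r beta T) :
  let succ := fun a b : V => l (T a) b in
  let prec := fun a b : V => r (T b) a in
  hom_pre_alternative prec succ beta
  /\ (hom_malcev_admissible mul alpha ->
      forall dot : V -> V -> V,
        associated_hom_pre_malcev (commutator mul) alpha
          (fun x v => l x v - r x v) beta T dot ->
        forall a b : V, dot a b = succ a b - prec b a).
Proof.
split; first exact: kupershmidt_hom_pre_alternative hA hV hT.
by move=> _ dot hdot a b; apply: (ahpm_dot hdot).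
Qed.
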